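(* Let $X$ be a topological space, let $Y$ be a regular Hausdorff space and let $f : X \to Y$ be globally multi-split continuous. Then the star multifunction $f^* : X \rightrightarrows Y$ is globally upper semicontinuous.
   Context: A neighborhood of a point $p$ (respectively of a subset $S$) in a topological space is a set $V$, not necessarily open, for which there is an open set $U$ with $p \in U \subseteq V$ (respectively $S \subseteq U \subseteq V$). Let $f : X \to Y$ be a function between topological spaces and $p \in X$. The function $f$ is multi-split continuous at $p$ if there exists a finite non-empty set $Z_p \subseteq Y$ such that: (a) for every $y \in Z_p$ and all neighborhoods $U \subseteq X$ of $p$ and $V \subseteq Y$ of $y$ one has $f(U) \cap V \neq \varnothing$; (b) for every neighborhood $V \subseteq Y$ of the set $Z_p$ there exists a neighborhood $U \subseteq X$ of $p$ with $f(U) \subseteq V$. Such a $Z_p$ is called a set of extended values of $f$ at $p$. The function $f$ is globally multi-split continuous if it is multi-split continuous at every $p \in X$. If $Y$ is Hausdorff, the set of extended values of $f$ at $p$ is unique. If $Y$ is Hausdorff and $f : X \to Y$ is globally multi-split continuous, its star multifunction is $f^* : X \rightrightarrows Y$, $p \mapsto Z_p$, where $Z_p$ is the set of extended values of $f$ at $p$. A multifunction $F : X \rightrightarrows Y$ is a map assigning to each $x \in X$ a subset $F(x) \subseteq Y$. It is upper semicontinuous at $p \in X$ if for every neighborhood $V \subseteq Y$ of $F(p)$ the set $\{x \in X : F(x) \subseteq V\}$ is a neighborhood of $p$; it is globally upper semicontinuous if it is upper semicontinuous at every $p \in X$. *)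

(* Defs.v *)
From HB Require Import structures.
From mathcomp Require Import all_boot all_order.
From mathcomp Require Import all_classical.
From mathcomp Require Import topology.

Set Implicit Arguments.
Unset Strict Implicit.
Unset Printing Implicit Defensive.

Local Open Scope classical_set_scope.

(* [nbhs p] and [set_nbhs Z] are the filters of all neighborhoods of a point
   and of a set, which need not be open; [set_nbhsE] turns the latter into
   the existence of an open set between [Z] and [V]. *)

Definition extended_values (X Y : topologicalType) (f : X -> Y) (p : X)
    (Z : set Y) : Prop :=
  [/\ finite_set Z, Z !=set0,
      forall y, Z y -> forall (U : set X) (V : set Y),
        nbhs p U -> nbhs y V -> (f @` U) `&` V !=set0
    & forall V : set Y, set_nbhs Z V ->
        exists2 U : set X, nbhs p U & f @` U `<=` V].

Definition multi_split_continuous_at (X Y : topologicalType) (f : X -> Y)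
    (p : X) : Prop :=
  exists Z : set Y, extended_values f p Z.

Definition multi_split_continuous (X Y : topologicalType) (f : X -> Y) : Prop :=
  forall p : X, multi_split_continuous_at f p.

(* The default [set0] is only reached where [f] is not multi-split continuous;
   if [Y] is Hausdorff, the value does not depend on any choice ([starE]). *)
Definition star (X Y : topologicalType) (f : X -> Y) : X -> set Y :=
  fun p => xget set0 (extended_values f p).

Definition usc_at (X Y : topologicalType) (F : X -> set Y) (p : X) : Prop :=
  forall V : set Y, set_nbhs (F p) V -> nbhs p [set x | F x `<=` V].

Definition usc (X Y : topologicalType) (F : X -> set Y) : Prop :=
  forall p : X, usc_at F p.

Lemma extended_values_sub (X Y : topologicalType) (hY : hausdorff_space Y)
    (f : X -> Y) (p : X) (Z1 Z2 : set Y) :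
  extended_values f p Z1 -> extended_values f p Z2 -> Z1 `<=` Z2.
Proof.
move=> [_ _ Z1f _] [Z2fin _ _ Z2f] y Z1y; apply: contrapT => Z2y.
have sep z : exists AB : set Y * set Y, Z2 z ->
    [/\ nbhs y AB.1, nbhs z AB.2 & AB.1 `&` AB.2 = set0].
  have [Z2z|?] := pselect (Z2 z); last by exists (set0, set0).
  have : ~ cluster (nbhs y) z by move=> /hY yz; apply: Z2y; rewrite yz.
  move=> /existsNP[A] /existsNP[B] /not_implyP[yA] /not_implyP[zB] AB.
  by exists (A, B) => _; split => //; apply: contra_notP AB => /eqP/set0P.
have {sep} [g gP] := choice sep.
have yA : nbhs y (\bigcap_(z in Z2) (g z).1).
  have /finite_fsetP[D Z2D] := Z2fin; rewrite Z2D.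
  by apply: filter_bigI => z zD; have [] // := gP z; rewrite Z2D.
have zB : set_nbhs Z2 (\bigcup_(z in Z2) (g z).2).
  move=> z Z2z; have [_ + _] := gP z Z2z.
  by apply: filterS => t tB; exists z.
have [U pU fU] := Z2f _ zB.
have [t [/fU[z Z2z zt] /(_ z Z2z) yt]] := Z1f y Z1y _ _ pU yA.
have [_ _ g0] := gP z Z2z.
by have : set0 t by rewrite -g0.
Qed.

Lemma starP (X Y : topologicalType) (f : X -> Y) (p : X) :
  multi_split_continuous_at f p -> extended_values f p (star f p).
Proof. exact: xgetPex. Qed.

Lemma starE (X Y : topologicalType) (hY : hausdorff_space Y) (f : X -> Y)
    (p : X) (Z : set Y) :
  extended_values f p Z -> star f p = Z.
Proof.
move=> pZ; have pS : extended_values f p (star f p) by apply: starP; exists Z.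
by apply/seteqP; split; apply: (extended_values_sub hY); eassumption.
Qed.

(* Main.v *)
Require Import Defs.
From mathcomp Require Import all_boot all_order.
From mathcomp Require Import all_classical.
From mathcomp Require Import topology.

Set Implicit Arguments.
Unset Strict Implicit.
Unset Printing Implicit Defensive.

(** Let [V] be a neighborhood of the finite set [star f p]. Regularity of [Y]
    shrinks [V] to a closed neighborhood [C] of [star f p]
    ([regular_finite_closed_nbhs]), and multi-split continuity at [p] gives a
    neighborhood [U] of [p] that [f] maps into [C]. At every point [x] interior
    to [U], all extended values of [f] are adherent to [f @` U]
    ([extended_values_sub_closed]), hence lie in the closed set [C], and so in
    [V]. A single neighborhood [U] thus works for all nearby [x]; regularity is
    what absorbs the passage from values of [f] to limits of values. *)

Local Open Scope classical_set_scope.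

(** Regularity provides closed neighborhoods of single points; finiteness of
    [A] keeps the union of those chosen around its points closed. *)
Lemma regular_finite_closed_nbhs (Y : topologicalType) (A V : set Y) :
  regular_space Y -> finite_set A -> set_nbhs A V ->
  exists C : set Y, [/\ closed C, set_nbhs A C & C `<=` V].
Proof.
move=> regY Afin AV.
have shrink z : exists B : set Y, A z -> nbhs z B /\ closure B `<=` V.
  have [Az|nAz] := pselect (A z); last by exists set0.
  by have [B zB BV] := regY z V (AV z Az); exists B.
have [B BP] := choice shrink.
exists (\bigcup_(z in A) closure (B z)); split.
- by apply: closed_bigcup => // z _; exact: closed_closure.
- move=> z Az; have [zB _] := BP z Az.
  by apply: filterS zB => t /subset_closure Bt; exists z.
- by apply: bigcup_sub => z /BP[].
Qed.

(** Every neighborhood of an extended value at [x] meets [f @` U], so extended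
    values are adherent to [f @` U]. *)
Lemma extended_values_sub_closed (X Y : topologicalType) (f : X -> Y) (x : X)
    (Z C : set Y) (U : set X) :
  extended_values f x Z -> nbhs x U -> closed C -> f @` U `<=` C -> Z `<=` C.
Proof.
move=> [_ _ Zf _] xU Ccl fUC y Zy; apply/Ccl/(closureS fUC) => W yW.
exact: (Zf y Zy U W xU yW).
Qed.

Theorem theorem4p3 (X Y : topologicalType) (f : X -> Y) :
  regular_space Y -> hausdorff_space Y ->
  multi_split_continuous f -> usc (star f).
Proof.
move=> regY _ fms p V pV.
have [pfin _ _ pf] := starP (fms p).
have [C [Ccl pC CV]] := regular_finite_closed_nbhs regY pfin pV.
have [U pU fUC] := pf C pC.
(* At points of the interior of [U], the set [U] is still a neighborhood. *)
apply: filterS (nbhs_interior pU) => x xU.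
apply: subset_trans CV.
exact: extended_values_sub_closed (starP (fms x)) xU Ccl fUC.
Qed.
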